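(* Let $\alpha\in(0,1)$ be irrational with continued fraction expansion $\alpha=[a_1,a_2,a_3,\ldots]$, and suppose $\limsup_{n\to\infty} a_n \neq 2$. Then for every real $\lambda\neq 0$ and every $\theta\in[0,1)$, the operator $H_{\lambda,\alpha,\theta}$ has empty point spectrum (i.e. it has no eigenvalues with eigenvector in $\ell^2(\mathbb Z)$).
   Context: For $\lambda\in\mathbb R$, irrational $\alpha\in(0,1)$ and $\theta\in[0,1)$, the Sturmian sequence is $v_{\alpha,\theta}(n)=\chi_{[1-\alpha,1)}(n\alpha+\theta \bmod 1)$, $n\in\mathbb Z$, and $H_{\lambda,\alpha,\theta}$ is the bounded self-adjoint operator on $\ell^2(\mathbb Z)$ given by $(H_{\lambda,\alpha,\theta}u)(n)=u(n+1)+u(n-1)+\lambda v_{\alpha,\theta}(n)u(n)$. The continued fraction expansion is $\alpha=1/(a_1+1/(a_2+1/(a_3+\cdots)))$ with uniquely determined $a_n\in\mathbb N=\{1,2,\ldots\}$. *)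

(* Defs.v *)
From Stdlib Require Import Reals ZArith.
From Coquelicot Require Import Coquelicot.
Open Scope R_scope.

(* floor and fractional part: Int_part x = up x - 1 = floor x *)
Definition frac (x : R) : R := x - IZR (Int_part x).

Definition irrational (x : R) : Prop :=
  ~ exists (p q : Z), q <> 0%Z /\ x = IZR p / IZR q.

Definition sturmian (alpha theta : R) (n : Z) : R :=
  if Rle_dec (1 - alpha) (frac (IZR n * alpha + theta)) then 1 else 0.

Fixpoint gauss_iter (alpha : R) (k : nat) : R :=
  match k with
  | O => alpha
  | S k' => frac (/ gauss_iter alpha k')
  end.

(* continued fraction digits: cf_digit alpha n = a_n for n >= 1,
   alpha = 1/(a_1 + 1/(a_2 + ...)); index 0 is a dummy value 0 *)
Definition cf_digit (alpha : R) (n : nat) : Z :=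
  match n with
  | O => 0%Z
  | S k => Int_part (/ gauss_iter alpha k)
  end.

Definition l2Z (u : Z -> C) : Prop :=
  ex_series (fun k : nat => (Cmod (u (Z.of_nat k)))^2) /\
  ex_series (fun k : nat => (Cmod (u (- Z.of_nat k)%Z))^2).

Definition H_op (lambda alpha theta : R) (u : Z -> C) (n : Z) : C :=
  (u (n + 1)%Z + u (n - 1)%Z + RtoC (lambda * sturmian alpha theta n) * u n)%C.

Definition is_eigenvalue (lambda alpha theta : R) (E : C) : Prop :=
  exists u : Z -> C, l2Z u /\ (exists n, u n <> 0%C) /\
    forall n : Z, H_op lambda alpha theta u n = (E * u n)%C.

(* Main.v *)
(* Suppose [u] is an eigenfunction. Grouping letters along the continued fraction
   expansion cuts the potential, at each level n, into words s_n and s_(n-1); let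
   M_n be the transfer matrix over s_n. Where the potential repeats a conjugate of
   s_n twice, Cayley-Hamilton gives u(j+p) + u(j-p) = tr(M_n) u(j), with p = |s_n|
   and j a site at the middle of the square.
   Every site is the middle of such a square of level n or n+1. At a site where |u|
   is maximal this forces |tr M_n| <= 2 or |tr M_(n+1)| <= 2 for all large n, so no
   spectral theory is needed; with the conserved Fricke polynomial of the trace
   map it bounds all tr M_n.
   If infinitely many a_n are at least 3, or if a_n = 1 eventually (the only two
   cases when limsup a_n <> 2), each site starts or ends squares of arbitrarily
   high level, and bounded traces then contradict the decay of [u] (Gordon). *)
Require Import Defs.
From Stdlib Require Import Reals ZArith.
From Coquelicot Require Import Coquelicot.
From Stdlib Require Import Lra Lia Psatz.
Open Scope R_scope.

(** * Transfer matrices *)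

Record mat2 : Type := Mat2 { m11 : C; m12 : C; m21 : C; m22 : C }.

Definition mmul (A B : mat2) : mat2 :=
  Mat2 (m11 A * m11 B + m12 A * m21 B)%C (m11 A * m12 B + m12 A * m22 B)%C
       (m21 A * m11 B + m22 A * m21 B)%C (m21 A * m12 B + m22 A * m22 B)%C.

Definition mid : mat2 := Mat2 (RtoC 1) (RtoC 0) (RtoC 0) (RtoC 1).

Definition tr (A : mat2) : C := (m11 A + m22 A)%C.

Definition det (A : mat2) : C := (m11 A * m22 A - m12 A * m21 A)%C.

Fixpoint mpow (A : mat2) (k : nat) : mat2 :=
  match k with O => mid | S k' => mmul A (mpow A k') end.

Lemma mat2_eq (a b c d a' b' c' d' : C) :
  a = a' -> b = b' -> c = c' -> d = d' -> Mat2 a b c d = Mat2 a' b' c' d'.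
Proof. now intros -> -> -> ->. Qed.

Lemma mmul_assoc (A B D : mat2) : mmul A (mmul B D) = mmul (mmul A B) D.
Proof. apply mat2_eq; simpl; ring. Qed.

Lemma mmul_id_l (A : mat2) : mmul mid A = A.
Proof. destruct A; apply mat2_eq; simpl; ring. Qed.

Lemma mmul_id_r (A : mat2) : mmul A mid = A.
Proof. destruct A; apply mat2_eq; simpl; ring. Qed.

Lemma tr_mmul (A B : mat2) : tr (mmul A B) = tr (mmul B A).
Proof. unfold tr; simpl; ring. Qed.

Lemma det_mmul (A B : mat2) : det (mmul A B) = (det A * det B)%C.
Proof. unfold det; simpl; ring. Qed.

Lemma det_mid : det mid = RtoC 1.
Proof. unfold det; simpl; ring. Qed.

Lemma det_mpow (A : mat2) (k : nat) : det A = RtoC 1 -> det (mpow A k) = RtoC 1.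
Proof.
  intros HA; induction k as [|k IH]; simpl; [apply det_mid|].
  rewrite det_mmul, HA, IH; ring.
Qed.

Lemma mpow_comm (A : mat2) (k : nat) : mmul (mpow A k) A = mmul A (mpow A k).
Proof.
  induction k as [|k IH]; simpl; [now rewrite mmul_id_l, mmul_id_r|].
  now rewrite <- mmul_assoc, IH.
Qed.

(** Multiplying the lone [x] or [y] by [det A = 1] turns each coordinate into a polynomial
    identity. *)
Lemma cayley_hamilton_vec (A : mat2) (x y : C) : det A = RtoC 1 ->
  (m11 A * (m11 A * x + m12 A * y) + m12 A * (m21 A * x + m22 A * y)
     = tr A * (m11 A * x + m12 A * y) - x)%C /\
  (m21 A * (m11 A * x + m12 A * y) + m22 A * (m21 A * x + m22 A * y)
     = tr A * (m21 A * x + m22 A * y) - y)%C.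
Proof.
  intros HA.
  assert (Hx : x = (det A * x)%C) by (rewrite HA; ring).
  assert (Hy : y = (det A * y)%C) by (rewrite HA; ring).
  split; [rewrite Hx at 4 | rewrite Hy at 4]; unfold tr, det; ring.
Qed.

(** * Traces of [B A^k] and the Fricke polynomial *)

Definition trpow (A B : mat2) (k : nat) : C := tr (mmul B (mpow A k)).

Lemma trpow_rec (A B : mat2) (k : nat) : det A = RtoC 1 ->
  trpow A B (S (S k)) = (tr A * trpow A B (S k) - trpow A B k)%C.
Proof.
  intros HA; unfold trpow; cbn [mpow]; generalize (mpow A k) as P; intros P.
  assert (Hd : tr (mmul B P) = (det A * tr (mmul B P))%C) by (rewrite HA; ring).
  rewrite Hd; unfold tr, det; simpl; ring.
Qed.

Lemma trpow_0 (A B : mat2) : trpow A B 0 = tr B.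
Proof. unfold trpow; simpl mpow; now rewrite mmul_id_r. Qed.

Lemma trpow_1 (A B : mat2) : trpow A B 1 = tr (mmul B A).
Proof. unfold trpow; simpl mpow; now rewrite mmul_id_r. Qed.

(** With [A] long and [B] short, this is the trace of new short times new long block one level
    up. *)
Lemma trpow_succ_sym (A B : mat2) (k : nat) :
  tr (mmul A (mmul B (mpow A k))) = trpow A B (S k).
Proof.
  rewrite tr_mmul; unfold trpow; cbn [mpow].
  now rewrite <- mmul_assoc, mpow_comm.
Qed.

(* Its value at the traces of [A], [B], [B A] is determined by the trace of the
   commutator, hence is the same at all levels. *)
Definition fricke (x y z : C) : C := (x * x + y * y + z * z - x * y * z)%C.

(** The polynomial is invariant under [(x, y, z) -> (x, z, x z - y)], which is the recurrence
    [trpow_rec]. *)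
Lemma fricke_trpow (A B : mat2) (k : nat) : det A = RtoC 1 ->
  fricke (tr A) (trpow A B k) (trpow A B (S k)) = fricke (tr A) (tr B) (tr (mmul B A)).
Proof.
  intros HA; rewrite <- trpow_1, <- (trpow_0 A B).
  induction k as [|k IH]; [reflexivity|].
  rewrite <- IH, (trpow_rec A B k HA); unfold fricke; ring.
Qed.

Lemma Cmod_lower (a b : C) : Cmod a - Cmod b <= Cmod (a - b)%C.
Proof.
  assert (H : a = ((a - b) + b)%C) by ring.
  pose proof (Cmod_triangle (a - b) b) as H1; rewrite <- H in H1; lra.
Qed.

(** By the recurrence [|t_(k+2)| >= |tr A| |t_(k+1)| - |t_k|], so moduli that have not decreased go
    on not decreasing when [|tr A| > 2]. *)
Lemma trpow_grows (A B : mat2) (k : nat) : det A = RtoC 1 ->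
  2 < Cmod (tr A) -> 2 < Cmod (tr (mmul B A)) -> Cmod (tr B) <= Cmod (tr (mmul B A)) ->
  2 < Cmod (trpow A B (S k)).
Proof.
  intros HA H1 H2 H3.
  enough (Cmod (trpow A B k) <= Cmod (trpow A B (S k)) /\ 2 < Cmod (trpow A B (S k))) by tauto.
  induction k as [|k [IH1 IH2]]; [now rewrite trpow_0, trpow_1|].
  rewrite (trpow_rec A B k HA).
  pose proof (Cmod_lower (tr A * trpow A B (S k)) (trpow A B k)) as H.
  rewrite Cmod_mult in H; nra.
Qed.

(** The equation is quadratic in [x] with bounded coefficients: [|x|^2 <= |F| + 4 |x| + 8]. *)
Lemma fricke_bound (x y z : C) (F : R) :
  Cmod y <= 2 -> Cmod z <= 2 -> fricke x y z = RtoC F -> 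
  Cmod x <= 8 + Rabs F.
Proof.
  intros Hy Hz HF.
  assert (Hx : (x * x = RtoC F + x * (y * z) - (y * y + z * z))%C).
  { rewrite <- HF; unfold fricke; ring. }
  assert (H1 : Cmod x * Cmod x <= Rabs F + Cmod x * 4 + 8).
  { rewrite <- Cmod_mult, Hx; unfold Cminus.
    eapply Rle_trans; [apply Cmod_triangle|]; rewrite Cmod_opp.
    pose proof (Cmod_triangle (RtoC F) (x * (y * z))) as T1.
    pose proof (Cmod_triangle (y * y) (z * z)) as T2.
    rewrite Cmod_R, !Cmod_mult in T1; rewrite !Cmod_mult in T2.
    pose proof (Cmod_ge_0 x); pose proof (Cmod_ge_0 y); pose proof (Cmod_ge_0 z).
    assert (Cmod y * Cmod z <= 4) by nra.
    assert (Cmod x * (Cmod y * Cmod z) <= Cmod x * 4) by nra.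
    nra. }
  pose proof (Rabs_pos F); pose proof (Cmod_ge_0 x).
  destruct (Rle_dec (Cmod x) (8 + Rabs F)); nra.
Qed.

(** * Transfer matrices of a potential and Gordon's identity *)

Section Transfer.

Variable q : Z -> R.
Variable E : C.

(** Acts on columns [(u n, u (n - 1))]; hence later factors stand on the left in [tmat]. *)
Definition transfer (n : Z) : mat2 := Mat2 (E - RtoC (q n))%C (- RtoC 1)%C (RtoC 1) (RtoC 0).

Fixpoint tmat (b : Z) (k : nat) : mat2 :=
  match k with O => mid | S k' => mmul (transfer (b + Z.of_nat k')) (tmat b k') end.

Lemma tmat_add (b : Z) (k m : nat) :
  tmat b (k + m) = mmul (tmat (b + Z.of_nat k) m) (tmat b k).
Proof.
  induction m as [|m IH]; [now rewrite Nat.add_0_r; simpl; rewrite mmul_id_l|].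
  rewrite Nat.add_succ_r; cbn [tmat]; rewrite IH, mmul_assoc.
  do 3 f_equal; lia.
Qed.

Lemma tmat_ext (b b' : Z) (k : nat) :
  (forall i, (0 <= i < Z.of_nat k)%Z -> q (b + i)%Z = q (b' + i)%Z) -> tmat b k = tmat b' k.
Proof.
  intros H; induction k as [|k IH]; [reflexivity|].
  cbn [tmat]; unfold transfer; rewrite (H (Z.of_nat k)) by lia.
  rewrite IH; [reflexivity|]; intros i Hi; apply H; lia.
Qed.

Lemma det_tmat (b : Z) (k : nat) : det (tmat b k) = RtoC 1.
Proof.
  induction k as [|k IH]; [apply det_mid|].
  cbn [tmat]; rewrite det_mmul, IH; unfold det, transfer; simpl.
  ring.
Qed.

(** The letter leaving the window equals the one entering it, so the two matrices are conjugate by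
    [transfer b]. *)
Lemma tr_tmat_shift (b : Z) (k : nat) : q b = q (b + Z.of_nat k)%Z ->
  tr (tmat (b + 1) k) = tr (tmat b k).
Proof.
  destruct k as [|k]; [reflexivity|]; intros H.
  replace (tmat b (S k)) with (mmul (tmat (b + 1) k) (transfer b)).
  - cbn [tmat]; rewrite tr_mmul; unfold transfer.
    replace (b + 1 + Z.of_nat k)%Z with (b + Z.of_nat (S k))%Z by lia.
    now rewrite <- H.
  - change (S k) with (1 + k)%nat; rewrite tmat_add; simpl tmat.
    now rewrite mmul_id_r, Z.add_0_r.
Qed.

(** [e] bounds the left member of each compared pair; the period governs all of [[b, e + p)]. *)
Definition periodic_on (p : nat) (b e : Z) : Prop :=
  forall i, (b <= i < e)%Z -> q i = q (i + Z.of_nat p)%Z.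

Lemma tr_tmat_slide (p : nat) (b e : Z) (k : nat) :
  periodic_on p b e -> (b + Z.of_nat k <= e)%Z ->
  tr (tmat (b + Z.of_nat k) p) = tr (tmat b p).
Proof.
  intros Hp; induction k as [|k IH]; intros Hk; [now rewrite Z.add_0_r|].
  rewrite <- IH by lia.
  replace (b + Z.of_nat (S k))%Z with (b + Z.of_nat k + 1)%Z by lia.
  apply tr_tmat_shift, Hp; lia.
Qed.

Variable u : Z -> C.
Hypothesis Hu : forall n : Z, (u (n + 1)%Z = (E - RtoC (q n)) * u n - u (n - 1)%Z)%C.

Lemma tmat_solution (b : Z) (k : nat) :
  (u (b + Z.of_nat k)%Z = m11 (tmat b k) * u b + m12 (tmat b k) * u (b - 1)%Z)%C /\
  (u (b + Z.of_nat k - 1)%Z = m21 (tmat b k) * u b + m22 (tmat b k) * u (b - 1)%Z)%C.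
Proof.
  induction k as [|k [IH1 IH2]]; [rewrite Z.add_0_r; simpl; split; ring|].
  replace (b + Z.of_nat (S k))%Z with (b + Z.of_nat k + 1)%Z by lia.
  replace (b + Z.of_nat k + 1 - 1)%Z with (b + Z.of_nat k)%Z by lia.
  rewrite Hu, IH2; cbn [tmat mmul m11 m12 m21 m22 transfer].
  split; rewrite IH1; ring.
Qed.

(* Cayley-Hamilton for the transfer matrix over one period, applied to both
   coordinates of the vector [(u j, u (j - 1))]. *)
Lemma gordon_square (p : nat) (b e j : Z) :
  periodic_on p b e -> (b <= j)%Z -> (j + Z.of_nat p <= e)%Z ->
  (u (j + 2 * Z.of_nat p)%Z = tr (tmat b p) * u (j + Z.of_nat p)%Z - u j)%C /\
  (u (j - 1 + 2 * Z.of_nat p)%Z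
     = tr (tmat b p) * u (j - 1 + Z.of_nat p)%Z - u (j - 1)%Z)%C.
Proof.
  intros Hp Hb He.
  assert (Ht : tr (tmat b p) = tr (tmat j p)).
  { rewrite <- (tr_tmat_slide p b e (Z.to_nat (j - b)) Hp) by lia.
    do 2 f_equal; lia. }
  rewrite Ht.
  assert (HM : tmat (j + Z.of_nat p) p = tmat j p).
  { symmetry; apply tmat_ext; intros i Hi; rewrite (Hp (j + i)%Z) by lia; f_equal; lia. }
  destruct (tmat_solution j p) as [A1 A2].
  destruct (tmat_solution (j + Z.of_nat p) p) as [B1 B2]; rewrite HM in B1, B2.
  destruct (cayley_hamilton_vec (tmat j p) (u j) (u (j - 1)%Z) (det_tmat j p)) as [C1 C2].
  replace (j + 2 * Z.of_nat p)%Z with (j + Z.of_nat p + Z.of_nat p)%Z by lia.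
  replace (j - 1 + 2 * Z.of_nat p)%Z with (j + Z.of_nat p + Z.of_nat p - 1)%Z by lia.
  replace (j - 1 + Z.of_nat p)%Z with (j + Z.of_nat p - 1)%Z by lia.
  split; [rewrite B1, A1, A2; exact C1 | rewrite B2, A1, A2; exact C2].
Qed.

End Transfer.

(** * Renormalization of Sturmian sequences *)

(* [c] tells which end of half-open intervals is closed: [0,m) or (0,m]. *)
Definition below (c : bool) (y m : R) : Prop := if c then y < m else y <= m.

(* A level cuts [Z] into long and short blocks starting at the points of [base].
   Block starts carry a coordinate in [0, gap_l + gap_s), on which passing to the
   next block is an exchange of two intervals: blocks with coordinate below
   [gap_l] are long and shift it by [gap_s], the others shift it by [- gap_l].
   [mat_l] and [mat_s] are the transfer matrices over the blocks. *)
Record level : Type := Level {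
  len_l : nat; len_s : nat;
  gap_l : R; gap_s : R;
  closed_left : bool;
  base : Z -> Prop;
  coord : Z -> R;
  mat_l : mat2; mat_s : mat2 }.

Definition is_l (v : level) (b : Z) : Prop :=
  base v b /\ below (closed_left v) (coord v b) (gap_l v).

Definition is_s (v : level) (b : Z) : Prop :=
  base v b /\ ~ below (closed_left v) (coord v b) (gap_l v).

Definition next_l (v : level) (b : Z) : Z := (b + Z.of_nat (len_l v))%Z.
Definition next_s (v : level) (b : Z) : Z := (b + Z.of_nat (len_s v))%Z.

(** The invariant carried through [step]: the interval exchange and its inverse [v_prev], the
    covering of [Z] by blocks, and the dependence of letters and matrices on the block type
    alone. *)
Record valid (q : Z -> R) (E : C) (v : level) : Prop := Valid {
  v_pos : 0 < gap_l v /\ 0 < gap_s v;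
  v_coord : forall b, base v b ->
    ~ below (closed_left v) (coord v b) 0 /\
    below (closed_left v) (coord v b) (gap_l v + gap_s v);
  v_next_l : forall b, is_l v b ->
    base v (next_l v b) /\ coord v (next_l v b) = coord v b + gap_s v;
  v_next_s : forall b, is_s v b ->
    base v (next_s v b) /\ coord v (next_s v b) = coord v b - gap_l v;
  v_prev : forall b, base v b ->
    exists b', base v b' /\
      ((~ below (closed_left v) (coord v b) (gap_s v) /\
         next_l v b' = b /\ coord v b' = coord v b - gap_s v) \/
       (below (closed_left v) (coord v b) (gap_s v) /\
         next_s v b' = b /\ coord v b' = coord v b + gap_l v));
  v_cover : forall j, exists b, (b <= j)%Z /\
    ((is_l v b /\ (j < next_l v b)%Z) \/ (is_s v b /\ (j < next_s v b)%Z));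
  (* Two letters short of what the block lengths allow: the words LS and SL
     agree except for their last two letters. *)
  v_agree : forall b b' i, base v b -> base v b' ->
    (0 <= i < Z.of_nat (len_l v) + Z.of_nat (len_s v) - 2)%Z -> q (b + i)%Z = q (b' + i)%Z;
  v_agree_l : forall b b' i, is_l v b -> is_l v b' ->
    (0 <= i < Z.of_nat (len_l v))%Z -> q (b + i)%Z = q (b' + i)%Z;
  v_agree_s : forall b b' i, is_s v b -> is_s v b' ->
    (0 <= i < Z.of_nat (len_s v))%Z -> q (b + i)%Z = q (b' + i)%Z;
  v_mat_l : forall b, is_l v b -> tmat q E b (len_l v) = mat_l v;
  v_mat_s : forall b, is_s v b -> tmat q E b (len_s v) = mat_s v;
  v_det : det (mat_l v) = RtoC 1 /\ det (mat_s v) = RtoC 1 }.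

(* New long block: [copies] long blocks followed by a short one; new short block:
   a long one. The coordinate is reflected, so the closed end flips. *)
Definition copies (v : level) : nat := Z.to_nat (Int_part (gap_l v / gap_s v)).

Definition rest (v : level) : R := gap_l v - INR (copies v) * gap_s v.

Definition step (v : level) : level := {|
  len_l := copies v * len_l v + len_s v;
  len_s := len_l v;
  gap_l := gap_s v;
  gap_s := rest v;
  closed_left := negb (closed_left v);
  base := fun b => base v b /\ below (closed_left v) (coord v b) (gap_s v + rest v);
  coord := fun b => gap_s v + rest v - coord v b;
  mat_l := mmul (mat_s v) (mpow (mat_l v) (copies v));
  mat_s := mat_l v |}.

Ltac below_lra :=
  unfold below in *; simpl closed_left in *;
  match goal with
  | _ : context [closed_left ?v] |- _ => destruct (closed_left v)
  | |- context [closed_left ?v] => destruct (closed_left v)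
  end;
  simpl negb in *; cbn iota in *; lra.

Section Step.

Variables (q : Z -> R) (E : C) (v : level).
Hypothesis Hv : valid q E v.
Hypothesis Hrest : 0 < rest v < gap_s v.

Let off (k : nat) : Z := (Z.of_nat k * Z.of_nat (len_l v))%Z.

Lemma run_l (b : Z) (k : nat) : base v b ->
  (forall i, (i < k)%nat -> below (closed_left v) (coord v b + INR i * gap_s v) (gap_l v)) ->
  base v (b + off k)%Z /\ coord v (b + off k)%Z = coord v b + INR k * gap_s v /\
  forall i, (i < k)%nat -> is_l v (b + off i)%Z.
Proof.
  unfold off; intros Hb; induction k as [|k IH]; intros Hk.
  - simpl Z.of_nat; rewrite Z.add_0_r; simpl INR; split; [exact Hb|split; [ring|lia]].
  - destruct IH as [H1 [H2 H3]]; [intros i Hi; apply Hk; lia|].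
    assert (HL : is_l v (b + Z.of_nat k * Z.of_nat (len_l v))).
    { split; [exact H1|]; rewrite H2; apply Hk; lia. }
    destruct (v_next_l _ _ _ Hv _ HL) as [H4 H5].
    replace (b + Z.of_nat (S k) * Z.of_nat (len_l v))%Z
      with (next_l v (b + Z.of_nat k * Z.of_nat (len_l v))) by (unfold next_l; lia).
    rewrite S_INR; split; [exact H4|split; [rewrite H5, H2; ring|]].
    intros i Hi; destruct (Nat.eq_dec i k) as [->|]; [exact HL|apply H3; lia].
Qed.

Lemma gap_l_eq : gap_l v = INR (copies v) * gap_s v + rest v.
Proof. unfold rest; ring. Qed.

Lemma copies_lt_gap (i k : nat) : (i < k)%nat -> INR i * gap_s v + gap_s v <= INR k * gap_s v.
Proof.
  intros Hi; assert (INR (S i) <= INR k) by (apply le_INR; lia); rewrite S_INR in *; nra.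
Qed.

Lemma copies_le_gap (i k : nat) : (i <= k)%nat -> INR i * gap_s v <= INR k * gap_s v.
Proof. intros Hi; assert (INR i <= INR k) by (apply le_INR; lia); nra. Qed.

Lemma base_step_run (b : Z) : base (step v) b ->
  base v (b + off (copies v))%Z /\
  coord v (b + off (copies v))%Z = coord v b + INR (copies v) * gap_s v /\
  forall i, (i < copies v)%nat -> is_l v (b + off i)%Z.
Proof.
  intros [Hb Hb2]; apply run_l; [exact Hb|]; intros i Hi.
  pose proof (copies_lt_gap i _ Hi); pose proof gap_l_eq; below_lra.
Qed.

Lemma is_l_step (b : Z) : is_l (step v) b ->
  (forall i, (i < copies v)%nat -> is_l v (b + off i)%Z) /\ is_s v (b + off (copies v))%Z.
Proof.
  intros [Hb Hb2]; destruct (base_step_run b Hb) as [H1 [H2 H3]].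
  split; [exact H3|split; [exact H1|]]; rewrite H2; simpl in Hb2.
  pose proof gap_l_eq; below_lra.
Qed.

(** A coordinate below [rest] leaves room for one long block more than [copies]. *)
Lemma is_s_step (b : Z) : is_s (step v) b ->
  base v b /\ (forall i, (i <= copies v)%nat -> is_l v (b + off i)%Z) /\
  coord v (next_l v b) = coord v b + gap_s v.
Proof.
  intros [[Hb Hb1] Hb2]; simpl in Hb2.
  destruct (run_l b (S (copies v)) Hb) as [H1 [H2 H3]].
  { intros i Hi; pose proof (copies_le_gap i (copies v)); pose proof gap_l_eq.
    specialize (H ltac:(lia)); below_lra. }
  split; [exact Hb|split; [intros i Hi; apply H3; lia|]].
  assert (HL : is_l v b) by (replace b with (b + off 0)%Z by (unfold off; lia); apply H3; lia).
  apply (v_next_l _ _ _ Hv _ HL).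
Qed.

(** Each step back over a long block lowers the coordinate by [gap_s], so at most [k] of them lead
    to a block preceded by a short one. *)
Lemma back_to_first (k : nat) : forall b, base v b ->
  below (closed_left v) (coord v b) (INR (S k) * gap_s v) ->
  exists i b0, base v b0 /\ below (closed_left v) (coord v b0) (gap_s v) /\
    b = (b0 + off i)%Z /\ coord v b = coord v b0 + INR i * gap_s v.
Proof.
  unfold off; induction k as [|k IH]; intros b Hb Hc.
  - exists 0%nat, b; simpl in *; rewrite Rmult_1_l in Hc; repeat split; auto; [lia|ring].
  - destruct (v_prev _ _ _ Hv b Hb) as [b' [Hb' [[H1 [H2 H3]]|[H1 [H2 H3]]]]].
    + destruct (IH b' Hb') as [i [b0 [I1 [I2 [I3 I4]]]]].
      { rewrite H3; rewrite S_INR in Hc; below_lra. }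
      exists (S i), b0; repeat split; auto.
      * rewrite <- H2, I3; unfold next_l; lia.
      * rewrite S_INR; lra.
    + exists 0%nat, b; simpl; repeat split; auto; [lia|ring].
Qed.

(** A short block has coordinate at least [gap_l], so before each of these steps back the coordinate
    still exceeds [gap_s] and the predecessor is long. *)
Lemma back_from_s (b : Z) (k : nat) : is_s v b -> (k <= copies v)%nat ->
  exists b0, base v b0 /\ b = (b0 + off k)%Z /\ coord v b = coord v b0 + INR k * gap_s v.
Proof.
  unfold off; intros [Hb HS]; induction k as [|k IH]; intros Hk.
  - exists b; simpl; split; [auto|split; [lia|ring]].
  - destruct IH as [b0 [I1 [I2 I3]]]; [lia|].
    pose proof (copies_lt_gap k (copies v) ltac:(lia)); pose proof gap_l_eq.
    destruct (v_prev _ _ _ Hv b0 I1) as [b' [Hb' [[K1 [K2 K3]]|[K1 [K2 K3]]]]].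
    + exists b'; split; [auto|]; unfold next_l in K2; rewrite S_INR; split; [lia|lra].
    + exfalso; below_lra.
Qed.

(** Between short blocks lie [copies] or [copies + 1] long ones. The longer runs split off their
    first block as a new short block; the remainder, with the closing short block, is a new long
    block. *)
Lemma cover_step (j : Z) : exists b, (b <= j)%Z /\
  ((is_l (step v) b /\ (j < next_l (step v) b)%Z) \/
   (is_s (step v) b /\ (j < next_s (step v) b)%Z)).
Proof.
  pose proof gap_l_eq as Hg; destruct (v_pos _ _ _ Hv) as [Hp1 Hp2].
  assert (Hl : forall b, base v b -> below (closed_left v) (coord v b) (gap_s v + rest v) ->
    ~ below (closed_left v) (coord v b) (rest v) -> is_l (step v) b).
  { intros b B1 B2 B3; split; [split; auto|simpl]; below_lra. }
  destruct (v_cover _ _ _ Hv j) as [b [Hbj [[[Hb HL] Hj]|[[Hb HS] Hj]]]]; unfold next_l, next_s in *.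
  - destruct (back_to_first (copies v) b Hb) as [i [b0 [H1 [H2 [H3 H4]]]]].
    { rewrite S_INR; below_lra. }
    assert (Hi : (i <= copies v)%nat).
    { destruct (Nat.le_gt_cases i (copies v)) as [|Hi]; [auto|exfalso].
      pose proof (copies_lt_gap _ _ Hi).
      pose proof (proj1 (v_coord _ _ _ Hv _ H1)); below_lra. }
    (* [b0] opens a run, which is one of the longer ones when its coordinate is below [rest]. *)
    assert (D : below (closed_left v) (coord v b0) (rest v) \/
              ~ below (closed_left v) (coord v b0) (rest v)).
    { unfold below; destruct (closed_left v); lra. }
    unfold off in *; simpl len_l; simpl len_s.
    destruct D as [D|D].
    + assert (HS : is_s (step v) b0).
      { split; [split; [exact H1|below_lra]|simpl; below_lra]. }
      destruct i as [|i].
      * exists b0; split; [lia|right; split; [exact HS|lia]].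
      * destruct (is_s_step b0 HS) as [S1 [S2 S3]].
        specialize (S2 0%nat ltac:(lia)); unfold off in S2; simpl in S2; rewrite Z.add_0_r in S2.
        destruct (v_next_l _ _ _ Hv _ S2) as [S4 _].
        exists (next_l v b0); unfold next_l in *; split; [nia|left; split; [|nia]].
        apply Hl; [exact S4| rewrite S3; below_lra |].
        rewrite S3; pose proof (proj1 (v_coord _ _ _ Hv _ H1)); below_lra.
    + assert (Hi' : (i < copies v)%nat).
      { destruct (Nat.eq_dec i (copies v)) as [->|]; [exfalso; below_lra|lia]. }
      exists b0; split; [nia|left; split; [|nia]].
      apply Hl; auto; below_lra.
  - destruct (back_from_s b (copies v) (conj Hb HS) (le_n _)) as [b0 [B1 [B2 B3]]]; unfold off in *.
    pose proof (v_coord _ _ _ Hv _ Hb) as [_ Hc].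
    exists b0; simpl len_l; split; [nia|left; split; [|nia]].
    apply Hl; auto; below_lra.
Qed.

Lemma tmat_run (b : Z) (k : nat) : (forall i, (i < k)%nat -> is_l v (b + off i)%Z) ->
  tmat q E b (k * len_l v) = mpow (mat_l v) k.
Proof.
  unfold off; induction k as [|k IH]; intros Hk; [reflexivity|].
  replace (S k * len_l v)%nat with (k * len_l v + len_l v)%nat by lia.
  rewrite tmat_add, IH by (intros i Hi; apply Hk; lia).
  rewrite Nat2Z.inj_mul, (v_mat_l _ _ _ Hv) by (apply Hk; lia); reflexivity.
Qed.

Lemma agree_run (b b' : Z) (k : nat) :
  (forall i, (i < k)%nat -> is_l v (b + off i)%Z) ->
  (forall i, (i < k)%nat -> is_l v (b' + off i)%Z) ->
  forall i, (0 <= i < off k)%Z -> q (b + i)%Z = q (b' + i)%Z.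
Proof.
  unfold off; induction k as [|k IH]; intros H H' i Hi; [lia|].
  destruct (Z.lt_ge_cases i (Z.of_nat k * Z.of_nat (len_l v))) as [Hik|Hik].
  - apply IH; [intros; apply H; lia|intros; apply H'; lia|lia].
  - pose proof (v_agree_l _ _ _ Hv _ _ (i - Z.of_nat k * Z.of_nat (len_l v))%Z
      (H k ltac:(lia)) (H' k ltac:(lia)) ltac:(lia)) as A.
    match goal with |- q ?x = q ?y =>
      match type of A with q ?x' = q ?y' =>
        replace x with x' by lia; replace y with y' by lia; exact A end end.
Qed.

Lemma agree_tail (b b' o : Z) (P : Z -> Prop) (m : Z) :
  P (b + o)%Z -> P (b' + o)%Z ->
  (forall x x' i, P x -> P x' -> (0 <= i < m)%Z -> q (x + i)%Z = q (x' + i)%Z) ->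
  forall i, (o <= i < o + m)%Z -> q (b + i)%Z = q (b' + i)%Z.
Proof.
  intros H H' A i Hi; specialize (A _ _ (i - o)%Z H H' ltac:(lia)).
  match goal with |- q ?x = q ?y =>
    match type of A with q ?x' = q ?y' =>
      replace x with x' by lia; replace y with y' by lia; exact A end end.
Qed.

Lemma valid_step : valid q E (step v).
Proof.
  pose proof gap_l_eq as Hg; destruct (v_pos _ _ _ Hv) as [Hp1 Hp2].
  assert (Hadj : forall b, is_s (step v) b -> is_l v b).
  { intros b Hb; replace b with (b + off 0)%Z by (unfold off; lia).
    apply (is_s_step b Hb); lia. }
  constructor.
  - simpl; lra.
  - intros b [Hb Hb2]; pose proof (v_coord _ _ _ Hv _ Hb) as [Hc _]; simpl.
    split; below_lra.
  - intros b Hb; destruct (is_l_step b Hb) as [H1 H2].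
    destruct (base_step_run b (proj1 Hb)) as [_ [H3 _]].
    destruct (v_next_s _ _ _ Hv _ H2) as [H4 H5].
    replace (next_l (step v) b) with (next_s v (b + off (copies v)))
      by (unfold next_l, next_s, off; simpl len_l; lia).
    destruct Hb as [[Hb Hb2] Hb3]; simpl in *.
    split; [split; [exact H4|]|]; rewrite H5, H3; [|lra].
    pose proof (v_coord _ _ _ Hv _ Hb) as [Hc _]; below_lra.
  - intros b Hb; destruct (is_s_step b Hb) as [H1 [_ H2]].
    destruct (v_next_l _ _ _ Hv _ (Hadj b Hb)) as [H3 _].
    destruct Hb as [[Hb Hb2] Hb3]; simpl in *.
    change (next_s (step v) b) with (next_l v b).
    split; [split; [exact H3|]|]; rewrite H2; [below_lra|ring].
  - intros b [Hb Hb2].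
    (* An old long predecessor is a new short block; an old short one ends a new long block. *)
    destruct (v_prev _ _ _ Hv b Hb) as [b' [Hb' [[H1 [H2 H3]]|[H1 [H2 H3]]]]].
    + exists b'; simpl; split; [split; [exact Hb'|below_lra]|right].
      split; [below_lra|split; [exact H2|lra]].
    + assert (HS : is_s v b').
      { split; [exact Hb'|]; rewrite H3.
        pose proof (v_coord _ _ _ Hv _ Hb) as [Hc _]; below_lra. }
      destruct (back_from_s b' (copies v) HS (le_n _)) as [b0 [B1 [B2 B3]]].
      exists b0; simpl; split; [split; [exact B1|below_lra]|left].
      split; [below_lra|split; [|lra]].
      rewrite <- H2, B2; unfold next_l, next_s, off; simpl len_l; lia.
  - exact cover_step.
  (* After [copies] long blocks both points reach old starts, which agree on [len_l + len_s - 2]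
     further letters. *)
  - intros b b' i Hb Hb' Hi; simpl in Hi.
    destruct (base_step_run b Hb) as [H1 [_ H2]].
    destruct (base_step_run b' Hb') as [H1' [_ H2']].
    destruct (Z.lt_ge_cases i (off (copies v))) as [Hik|Hik].
    + now apply (agree_run b b' (copies v)).
    + apply (agree_tail b b' _ (base v) _ H1 H1' (v_agree _ _ _ Hv)); unfold off in *; lia.
  - intros b b' i Hb Hb' Hi; simpl in Hi.
    destruct (is_l_step b Hb) as [H1 H2], (is_l_step b' Hb') as [H1' H2'].
    destruct (Z.lt_ge_cases i (off (copies v))) as [Hik|Hik].
    + now apply (agree_run b b' (copies v)).
    + apply (agree_tail b b' _ (is_s v) _ H2 H2' (v_agree_s _ _ _ Hv)); unfold off in *; lia.
  - intros b b' i Hb Hb' Hi; simpl in Hi.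
    apply (v_agree_l _ _ _ Hv); auto.
  - intros b Hb; destruct (is_l_step b Hb) as [H1 H2]; unfold off in H2; simpl len_l.
    rewrite tmat_add, (tmat_run b _ H1), Nat2Z.inj_mul, (v_mat_s _ _ _ Hv _ H2); reflexivity.
  - intros b Hb; simpl; now apply (v_mat_l _ _ _ Hv), Hadj.
  - destruct (v_det _ _ _ Hv) as [D1 D2]; simpl; split; [|exact D1].
    rewrite det_mmul, D2, det_mpow by exact D1; ring.
Qed.

End Step.

(** * Squares *)

Section Windows.

Variables (q : Z -> R) (E : C) (v : level).
Hypothesis Hv : valid q E v.
Hypothesis Hlen : (2 <= len_s v)%nat.

(** Whatever block follows the run, its start agrees with that of the last long block on
    [len_l + len_s - 2] letters, so the period persists past the run. *)
Lemma periodic_run (b : Z) (k : nat) :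
  (forall i, (i <= k)%nat -> is_l v (b + Z.of_nat i * Z.of_nat (len_l v))%Z) ->
  periodic_on q (len_l v) b
    (b + Z.of_nat (S k) * Z.of_nat (len_l v) + Z.of_nat (len_s v) - 2)%Z.
Proof.
  induction k as [|k IH]; intros H i Hi.
  - specialize (H 0%nat ltac:(lia)); rewrite Z.add_0_r in H.
    destruct (v_next_l _ _ _ Hv _ H) as [H1 _].
    pose proof (v_agree _ _ _ Hv _ _ (i - b)%Z (proj1 H) H1 ltac:(lia)) as A.
    unfold next_l in A.
    replace (b + (i - b))%Z with i in A by lia; rewrite A; f_equal; lia.
  - destruct (Z.lt_ge_cases i (b + Z.of_nat (S k) * Z.of_nat (len_l v))) as [Hik|Hik].
    + apply IH; [intros; apply H; lia|lia].
    + specialize (H (S k) ltac:(lia)).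
      destruct (v_next_l _ _ _ Hv _ H) as [H1 _].
      set (b1 := (b + Z.of_nat (S k) * Z.of_nat (len_l v))%Z) in *.
      pose proof (v_agree _ _ _ Hv _ _ (i - b1)%Z (proj1 H) H1 ltac:(lia)) as A.
      unfold next_l in A.
      replace (b1 + (i - b1))%Z with i in A by lia; rewrite A; f_equal; lia.
Qed.

Hypothesis Hrest : 0 < rest v < gap_s v.

Lemma periodic_is_l_step (b : Z) : (1 <= copies v)%nat -> is_l (step v) b ->
  is_l v b /\ periodic_on q (len_l v) b
    (b + Z.of_nat (copies v) * Z.of_nat (len_l v) + Z.of_nat (len_s v) - 2)%Z.
Proof.
  intros Ha Hb; destruct (is_l_step q E v Hv Hrest b Hb) as [H1 _].
  split; [specialize (H1 0%nat ltac:(lia)); now rewrite Z.add_0_r in H1|].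
  replace (copies v) with (S (pred (copies v))) by lia.
  apply periodic_run; intros i Hi; apply H1; lia.
Qed.

Lemma periodic_is_s_step (b : Z) : is_s (step v) b ->
  is_l v b /\ periodic_on q (len_l v) b
    (b + Z.of_nat (S (copies v)) * Z.of_nat (len_l v) + Z.of_nat (len_s v) - 2)%Z.
Proof.
  intros Hb; destruct (is_s_step q E v Hv Hrest b Hb) as [_ [H1 _]].
  split; [specialize (H1 0%nat ltac:(lia)); now rewrite Z.add_0_r in H1|].
  apply periodic_run; intros i Hi; apply H1; lia.
Qed.

End Windows.

(** The square is [[c - p, c + p)]. Both [c = j] and [c = j + 1] serve, since [gordon_square]
    controls [u c] and [u (c - 1)]; this freedom makes up for the letters lost in [v_agree]. *)
Definition square_centre (q : Z -> R) (w : level) (j : Z) : Prop := exists b e c,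
  is_l w b /\ periodic_on q (len_l w) b e /\ (c = j \/ c = j + 1)%Z /\
  (b <= c - Z.of_nat (len_l w))%Z /\ (c <= e)%Z.

(* The block one level up that contains [j + 1] has a predecessor block; a long
   predecessor gives a square of the longer period, a short one a square of the
   shorter period. *)
Lemma square_centre_or_step (q : Z -> R) (E : C) (v : level) (j : Z) :
  valid q E v -> 0 < rest v < gap_s v -> (2 <= len_l v)%nat -> (2 <= len_s v)%nat ->
  square_centre q v j \/ square_centre q (step v) j.
Proof.
  intros Hv Hrest Hll Hls.
  pose proof (valid_step q E v Hv Hrest) as Hw.
  destruct (v_pos _ _ _ Hw) as [Hg1 Hg2].
  assert (Hgap : gap_s (step v) < gap_l (step v)) by (simpl; lra).
  destruct (v_cover _ _ _ Hw (j + 1)%Z) as [b [Hbj Hb]].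
  assert (Hbase : base (step v) b) by (destruct Hb as [[[? ?] ?]|[[? ?] ?]]; assumption).
  destruct (v_prev _ _ _ Hw b Hbase) as [b' [Hb' [[H1 [H2 H3]]|[H1 [H2 H3]]]]].
  - right.
    assert (HL' : is_l (step v) b').
    { split; [exact Hb'|]; pose proof (proj2 (v_coord _ _ _ Hw _ Hbase)); rewrite H3.
      below_lra. }
    unfold next_l in H2, Hb; unfold next_s in Hb.
    destruct Hb as [[HL Hj]|[HS Hj]].
    + exists b', (b' + Z.of_nat 2 * Z.of_nat (len_l (step v))
        + Z.of_nat (len_s (step v)) - 2)%Z, (j + 1)%Z.
      split; [exact HL'|split; [|change (len_s (step v)) with (len_l v); split; [tauto|lia]]].
      apply (periodic_run q E (step v) Hw Hll); intros i Hi.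
      destruct i as [|[|]]; [now rewrite Z.add_0_r| |lia].
      rewrite Z.mul_1_l, H2; exact HL.
    + set (e := (b' + Z.of_nat 1 * Z.of_nat (len_l (step v))
        + Z.of_nat (len_s (step v)) - 2)%Z).
      assert (Hp : periodic_on q (len_l (step v)) b' e).
      { apply (periodic_run q E (step v) Hw Hll); intros i Hi.
        replace i with 0%nat by lia; now rewrite Z.add_0_r. }
      assert (He : e = (b + Z.of_nat (len_l v) - 2)%Z).
      { unfold e; change (len_s (step v)) with (len_l v); lia. }
      change (len_s (step v)) with (len_l v) in Hj.
      (* Only the last site of the block exceeds [e]; if [j + 1] is that site, the centre is
         [j = e]. *)
      clearbody e; exists b', e; destruct (Z.le_gt_cases (j + 1) e).
      * exists (j + 1)%Z; split; [exact HL'|split; [exact Hp|]]; split; [tauto|lia].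
      * exists j; split; [exact HL'|split; [exact Hp|]]; split; [tauto|lia].
  - left.
    assert (HL : is_l (step v) b) by (split; [exact Hbase|below_lra]).
    assert (HS : is_s (step v) b').
    { split; [exact Hb'|]; rewrite H3.
      pose proof (proj1 (v_coord _ _ _ Hw _ Hbase)); below_lra. }
    assert (Hj : (j + 1 < next_l (step v) b)%Z).
    { destruct Hb as [[_ Hj]|[[_ HS'] _]]; [exact Hj|destruct (HS' (proj2 HL))]. }
    (* The period started by the short block [b'] runs on through the long block [b], up to two
       letters. *)
    destruct (periodic_is_s_step q E v Hv Hls Hrest b' HS) as [HL0 Hp].
    unfold next_l, next_s in *; simpl len_l in Hj; simpl len_s in H2.
    set (e := (b' + Z.of_nat (S (copies v)) * Z.of_nat (len_l v) + Z.of_nat (len_s v) - 2)%Z) in Hp.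
    assert (He : e = (b + Z.of_nat (copies v) * Z.of_nat (len_l v) + Z.of_nat (len_s v) - 2)%Z)
      by (unfold e; lia).
    clearbody e; exists b', e.
    destruct (Z.le_gt_cases (j + 1) e).
    + exists (j + 1)%Z; split; [exact HL0|split; [exact Hp|]]; split; [tauto|lia].
    + exists j; split; [exact HL0|split; [exact Hp|]]; split; [tauto|lia].
Qed.

(** The square gives [tr * u j = u x + u y], whose right side is at most [2 |u j|] at a maximum. *)
Lemma square_at_max (q : Z -> R) (E : C) (u : Z -> C) (v : level) (j : Z) :
  (forall n : Z, (u (n + 1)%Z = (E - RtoC (q n)) * u n - u (n - 1)%Z)%C) ->
  valid q E v -> square_centre q v j -> u j <> RtoC 0 ->
  (forall i, Cmod (u i) <= Cmod (u j)) -> Cmod (tr (mat_l v)) <= 2.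
Proof.
  intros Hu Hv [b [e [c [HL [Hp [Hc [Hb He]]]]]]] Hj Hmax.
  destruct (gordon_square q E u Hu _ b e (c - Z.of_nat (len_l v))%Z Hp Hb ltac:(lia))
    as [G1 G2].
  rewrite (v_mat_l _ _ _ Hv _ HL) in G1, G2.
  assert (G : exists x y, (tr (mat_l v) * u j = u x + u y)%C).
  { destruct Hc as [Hc|Hc]; [eexists _, _; symmetry in G1|eexists _, _; symmetry in G2].
    - replace (c - Z.of_nat (len_l v) + Z.of_nat (len_l v))%Z with j in G1 by lia.
      instantiate (2 := (c - Z.of_nat (len_l v) + 2 * Z.of_nat (len_l v))%Z).
      rewrite <- G1; instantiate (1 := (c - Z.of_nat (len_l v))%Z); ring.
    - replace (c - Z.of_nat (len_l v) - 1 + Z.of_nat (len_l v))%Z with j in G2 by lia.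
      instantiate (2 := (c - Z.of_nat (len_l v) - 1 + 2 * Z.of_nat (len_l v))%Z).
      rewrite <- G2; instantiate (1 := (c - Z.of_nat (len_l v) - 1)%Z); ring. }
  destruct G as [x [y G]].
  pose proof (Cmod_triangle (u x) (u y)) as T; rewrite <- G, Cmod_mult in T.
  pose proof (Hmax x); pose proof (Hmax y); pose proof (Cmod_gt_0 (u j)) as [P _].
  specialize (P Hj); nra.
Qed.

(** * Squares starting or ending at a site *)

(** The square is [[j, j + 2p)] or [[j - 2p, j)]; Gordon's identity then expresses [u j] by values
    at distances [p] and [2p]. *)
Definition square_beside (q : Z -> R) (v : level) (j : Z) : Prop := exists b e,
  is_l v b /\ periodic_on q (len_l v) b e /\
  ((b <= j /\ j + Z.of_nat (len_l v) <= e) \/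
   (b <= j - 2 * Z.of_nat (len_l v) /\ j - Z.of_nat (len_l v) <= e))%Z.

Lemma square_beside_bound (q : Z -> R) (E : C) (u : Z -> C) (v : level) (j : Z) (eps : R) :
  (forall n : Z, (u (n + 1)%Z = (E - RtoC (q n)) * u n - u (n - 1)%Z)%C) ->
  valid q E v -> square_beside q v j ->
  (forall i, (Z.of_nat (len_l v) <= Z.abs (i - j))%Z -> Cmod (u i) <= eps) ->
  Cmod (u j) <= (Cmod (tr (mat_l v)) + 1) * eps.
Proof.
  intros Hu Hv [b [e [HL [Hp Hj]]]] Heps.
  assert (G : exists x y, (Z.of_nat (len_l v) <= Z.abs (x - j))%Z /\
     (Z.of_nat (len_l v) <= Z.abs (y - j))%Z /\ (u j = tr (mat_l v) * u x - u y)%C).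
  { destruct Hj as [[Hb He]|[Hb He]].
    - destruct (gordon_square q E u Hu _ b e j Hp Hb He) as [G _].
      rewrite (v_mat_l _ _ _ Hv _ HL) in G.
      exists (j + Z.of_nat (len_l v))%Z, (j + 2 * Z.of_nat (len_l v))%Z.
      split; [lia|split; [lia|]]; rewrite G; ring.
    - destruct (gordon_square q E u Hu _ b e _ Hp Hb ltac:(lia)) as [G _].
      rewrite (v_mat_l _ _ _ Hv _ HL) in G.
      exists (j - 2 * Z.of_nat (len_l v) + Z.of_nat (len_l v))%Z, (j - 2 * Z.of_nat (len_l v))%Z.
      split; [lia|split; [lia|]]; rewrite <- G; f_equal; lia. }
  destruct G as [x [y [Hx [Hy G]]]].
  rewrite G; unfold Cminus; eapply Rle_trans; [apply Cmod_triangle|].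
  rewrite Cmod_opp, Cmod_mult.
  pose proof (Heps x Hx); pose proof (Heps y Hy); pose proof (Cmod_ge_0 (tr (mat_l v))); nra.
Qed.

Lemma square_beside_three (q : Z -> R) (E : C) (v : level) (j : Z) :
  valid q E v -> 0 < rest v < gap_s v -> (2 <= len_s v)%nat -> (2 <= len_l v)%nat ->
  (3 <= copies v)%nat -> square_beside q v j.
Proof.
  intros Hv Hrest Hls Hll Ha.
  destruct (v_cover _ _ _ (valid_step q E v Hv Hrest) j) as [b [Hbj [[Hb Hj]|[Hb Hj]]]].
  - destruct (periodic_is_l_step q E v Hv Hls Hrest b ltac:(lia) Hb) as [HL Hp].
    unfold next_l in Hj; simpl len_l in Hj.
    exists b; eexists; split; [exact HL|split; [exact Hp|]].
    (* Sites in the first two copies start a square; later ones have two full periods behind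
       them. *)
    destruct (Z.lt_ge_cases (j - b) (2 * Z.of_nat (len_l v))); [left|right]; nia.
  - destruct (periodic_is_s_step q E v Hv Hls Hrest b Hb) as [HL Hp].
    unfold next_s in Hj; simpl len_s in Hj.
    exists b; eexists; split; [exact HL|split; [exact Hp|]]; left; nia.
Qed.

Lemma square_beside_short (q : Z -> R) (E : C) (v : level) (b j : Z) :
  valid q E v -> 0 < rest v < gap_s v -> (2 <= len_s v)%nat -> (1 <= copies v)%nat ->
  is_s (step v) b -> (b <= j < next_s (step v) b)%Z -> square_beside q v j.
Proof.
  intros Hv Hrest Hls Ha Hb Hj.
  destruct (periodic_is_s_step q E v Hv Hls Hrest b Hb) as [HL Hp].
  unfold next_s in Hj; simpl len_s in Hj.
  exists b; eexists; split; [exact HL|split; [exact Hp|]]; left; nia.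
Qed.

(** With one copy guaranteed, the comparisons reach [b + p + len_s - 2], so a square starts at each
    early site. *)
Lemma square_beside_long (q : Z -> R) (E : C) (v : level) (b j : Z) :
  valid q E v -> 0 < rest v < gap_s v -> (2 <= len_s v)%nat -> (1 <= copies v)%nat ->
  is_l (step v) b -> (b <= j <= b + Z.of_nat (len_s v) - 2)%Z -> square_beside q v j.
Proof.
  intros Hv Hrest Hls Ha Hb Hj.
  destruct (periodic_is_l_step q E v Hv Hls Hrest b Ha Hb) as [HL Hp].
  exists b; eexists; split; [exact HL|split; [exact Hp|]]; left; nia.
Qed.

(** * The levels of a Sturmian sequence *)

Lemma frac_bounds (x : R) : 0 <= frac x < 1.
Proof. unfold frac; destruct (base_Int_part x); lra. Qed.

Lemma frac_unique (x y : R) (z : Z) : 0 <= y < 1 -> x = IZR z + y -> frac x = y.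
Proof.
  intros Hy Hx; unfold frac.
  rewrite <- (Int_part_spec x z) by lra; lra.
Qed.

Lemma frac_plus_lt (x a : R) : 0 <= frac x + a < 1 -> frac (x + a) = frac x + a.
Proof. intros H; apply frac_unique with (Int_part x); [exact H|unfold frac; ring]. Qed.

Lemma frac_plus_ge (x a : R) : 0 <= frac x + a - 1 < 1 -> frac (x + a) = frac x + a - 1.
Proof.
  intros H; apply frac_unique with (Int_part x + 1)%Z; [exact H|].
  rewrite plus_IZR; unfold frac; ring.
Qed.

Lemma frac_plus_IZR (x : R) (z : Z) : frac (x + IZR z) = frac x.
Proof.
  apply frac_unique with (Int_part x + z)%Z; [apply frac_bounds|].
  rewrite plus_IZR; unfold frac; ring.
Qed.

Lemma irrational_plus_IZR (x : R) (z : Z) : irrational x -> irrational (x + IZR z).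
Proof.
  intros H [p [d [Hd He]]]; apply H; exists (p - z * d)%Z, d; split; [exact Hd|].
  assert (IZR d <> 0) by now apply not_0_IZR.
  rewrite minus_IZR, mult_IZR; apply Rmult_eq_reg_r with (IZR d); [|assumption].
  replace x with (IZR p / IZR d - IZR z) by lra; field; assumption.
Qed.

Lemma irrational_neq_IZR (x : R) (z : Z) : irrational x -> x <> IZR z.
Proof. intros H He; apply H; exists z, 1%Z; split; [lia|]; rewrite He; field. Qed.

Lemma irrational_inv (x : R) : irrational x -> irrational (/ x).
Proof.
  intros H [p [d [Hd He]]].
  assert (Hx : x <> 0) by apply (irrational_neq_IZR x 0 H).
  assert (IZR d <> 0) by now apply not_0_IZR.
  assert (Hp : p <> 0%Z).
  { intros ->; apply (Rinv_neq_0_compat x Hx); rewrite He; field; assumption. }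
  apply H; exists d, p; split; [exact Hp|].
  assert (IZR p <> 0) by now apply not_0_IZR.
  rewrite <- (Rinv_inv x), He; field; auto.
Qed.

Lemma irrational_frac (x : R) : irrational x -> irrational (frac x).
Proof.
  intros H; unfold frac, Rminus; rewrite <- opp_IZR; now apply irrational_plus_IZR.
Qed.

Lemma frac_pos (x : R) : irrational x -> 0 < frac x < 1.
Proof.
  intros H; destruct (frac_bounds x) as [[H1|H1] H2]; [lra|exfalso].
  now apply (irrational_neq_IZR (frac x) 0 (irrational_frac x H)).
Qed.

Lemma Int_part_pos (x : R) : 1 < x -> (1 <= Int_part x)%Z.
Proof.
  intros H; destruct (base_Int_part x) as [H1 H2].
  assert (0 < Int_part x)%Z by (apply lt_IZR; lra); lia.
Qed.

Lemma Int_part_nonneg (x : R) : 0 < x -> (0 <= Int_part x)%Z.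
Proof.
  intros H; destruct (base_Int_part x) as [H1 H2].
  assert (-1 < Int_part x)%Z by (apply lt_IZR; lra); lia.
Qed.

(** Euclidean division of the gaps: under [step] their ratio evolves by the Gauss map. *)
Lemma rest_eq (v : level) : 0 < gap_l v -> 0 < gap_s v ->
  rest v = gap_s v * frac (gap_l v / gap_s v).
Proof.
  intros H1 H2; unfold rest, frac, copies.
  rewrite INR_IZR_INZ, Z2Nat.id by (apply Int_part_nonneg, Rdiv_lt_0_compat; assumption).
  field; lra.
Qed.

Lemma rest_bounds (v : level) : 0 < gap_l v -> 0 < gap_s v ->
  irrational (gap_l v / gap_s v) -> 0 < rest v < gap_s v.
Proof.
  intros H1 H2 H; rewrite rest_eq by assumption; pose proof (frac_pos _ H); nra.
Qed.

Section Sturmian.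

Variables (alpha theta lambda : R) (E : C).
Hypothesis Ha : 0 < alpha < 1.
Hypothesis Hirr : irrational alpha.

Definition potential (n : Z) : R := lambda * sturmian alpha theta n.

(** Blocks are single letters: long for value 0, short for value [lambda]. The names say nothing yet
    about size, and [copies] here is [a_1 - 1], possibly 0. *)
Definition level0 : level := {|
  len_l := 1; len_s := 1;
  gap_l := 1 - alpha; gap_s := alpha;
  closed_left := true;
  base := fun _ => True;
  coord := fun b => frac (IZR b * alpha + theta);
  mat_l := Mat2 E (- RtoC 1)%C (RtoC 1) (RtoC 0);
  mat_s := Mat2 (E - RtoC lambda)%C (- RtoC 1)%C (RtoC 1) (RtoC 0) |}.

Fixpoint lev (n : nat) : level :=
  match n with O => level0 | S n' => step (lev n') end.

Lemma potential_l (b : Z) : is_l level0 b -> potential b = 0.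
Proof.
  intros [_ H]; unfold below in H; simpl in H; unfold potential, sturmian.
  destruct (Rle_dec _ _); [lra|ring].
Qed.

Lemma potential_s (b : Z) : is_s level0 b -> potential b = lambda.
Proof.
  intros [_ H]; unfold below in H; simpl in H; unfold potential, sturmian.
  destruct (Rle_dec _ _); [ring|lra].
Qed.

Lemma valid_level0 : valid potential E level0.
Proof.
  assert (Hf : forall b : Z, 0 <= frac (IZR b * alpha + theta) < 1)
    by (intros; apply frac_bounds).
  assert (Hs : forall b : Z, IZR (b + 1) * alpha + theta = IZR b * alpha + theta + alpha)
    by (intros; rewrite plus_IZR; ring).
  constructor.
  - simpl; lra.
  - intros b _; unfold below; simpl; pose proof (Hf b); lra.
  - intros b [_ H]; unfold below in H; simpl in *; split; [exact I|]; unfold next_l; simpl.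
    rewrite Hs; pose proof (Hf b); apply frac_plus_lt; lra.
  - intros b [_ H]; unfold below in H; simpl in *; split; [exact I|]; unfold next_s; simpl.
    rewrite Hs, frac_plus_ge; pose proof (Hf b); lra.
  - intros b _; exists (b - 1)%Z; split; [exact I|].
    unfold next_l, next_s, below; simpl.
    assert (Hb : frac (IZR b * alpha + theta) = frac (IZR (b - 1) * alpha + theta + alpha))
      by (rewrite <- Hs; do 4 f_equal; lia).
    rewrite Hb.
    pose proof (Hf (b - 1)%Z) as H0.
    destruct (Rlt_dec (frac (IZR (b - 1) * alpha + theta) + alpha) 1).
    + left; rewrite (frac_plus_lt (IZR (b - 1) * alpha + theta)) by lra.
      split; [lra|split; [lia|lra]].
    + right; rewrite (frac_plus_ge (IZR (b - 1) * alpha + theta)) by lra.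
      split; [lra|split; [lia|lra]].
  - intros j; exists j; split; [lia|].
    destruct (Rlt_dec (frac (IZR j * alpha + theta)) (1 - alpha)) as [H|H]; [left|right];
      (split; [split; [exact I|exact H]|]); unfold next_l, next_s; simpl; lia.
  (* The range is empty: [1 + 1 - 2 = 0]. *)
  - intros b b' i _ _ Hi; simpl in Hi; lia.
  - intros b b' i Hb Hb' Hi; simpl in Hi; replace i with 0%Z by lia; rewrite !Z.add_0_r.
    now rewrite !potential_l.
  - intros b b' i Hb Hb' Hi; simpl in Hi; replace i with 0%Z by lia; rewrite !Z.add_0_r.
    now rewrite !potential_s.
  - intros b Hb; simpl; rewrite mmul_id_r, Z.add_0_r; unfold transfer.
    rewrite (potential_l b Hb); apply mat2_eq; ring.
  - intros b Hb; simpl; rewrite mmul_id_r, Z.add_0_r; unfold transfer.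
    now rewrite (potential_s b Hb).
  - unfold det; simpl; split; ring.
Qed.

(** Irrationality of the gap ratio is carried along because it keeps [rest] positive. *)
Lemma lev_spec (n : nat) :
  valid potential E (lev n) /\ irrational (gap_l (lev n) / gap_s (lev n)).
Proof.
  induction n as [|n [IH1 IH2]].
  - split; [exact valid_level0|]; simpl.
    replace ((1 - alpha) / alpha) with (/ alpha + IZR (-1)) by (field; lra).
    now apply irrational_plus_IZR, irrational_inv.
  - destruct (v_pos _ _ _ IH1) as [H1 H2].
    split; [apply valid_step; [exact IH1|now apply rest_bounds]|].
    simpl; rewrite rest_eq by assumption.
    pose proof (frac_pos _ IH2).
    replace (gap_s (lev n) / _) with (/ frac (gap_l (lev n) / gap_s (lev n))) by (field; lra).
    now apply irrational_inv, irrational_frac.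
Qed.

Definition lev_valid (n : nat) : valid potential E (lev n) := proj1 (lev_spec n).

Lemma lev_rest (n : nat) : 0 < rest (lev n) < gap_s (lev n).
Proof.
  destruct (lev_spec n) as [H1 H2]; destruct (v_pos _ _ _ H1); now apply rest_bounds.
Qed.

Lemma lev_gauss (n : nat) :
  gap_l (lev (S n)) / gap_s (lev (S n)) = / gauss_iter alpha (S n).
Proof.
  assert (H : forall n, gap_l (lev (S n)) / gap_s (lev (S n))
    = / frac (gap_l (lev n) / gap_s (lev n))).
  { intros m; destruct (lev_spec m) as [H1 H2]; destruct (v_pos _ _ _ H1).
    pose proof (frac_pos _ H2); simpl; rewrite rest_eq by assumption; field; lra. }
  induction n as [|n IH]; rewrite H; f_equal.
  - simpl; replace ((1 - alpha) / alpha) with (/ alpha + IZR (-1)) by (field; lra).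
    apply frac_plus_IZR.
  - rewrite IH; reflexivity.
Qed.

(** From level 1 on the long gap exceeds the short one, and level [n] has copy number [a_(n+1)]. *)
Lemma lev_copies (n : nat) : (1 <= copies (lev (S n)))%nat /\
  cf_digit alpha (S (S n)) = Z.of_nat (copies (lev (S n))).
Proof.
  destruct (lev_spec (S n)) as [H1 H2]; destruct (v_pos _ _ _ H1) as [P1 P2].
  assert (1 < gap_l (lev (S n)) / gap_s (lev (S n))).
  { pose proof (lev_rest n); simpl in *.
    apply Rmult_lt_reg_r with (rest (lev n)); [lra|].
    unfold Rdiv; rewrite Rmult_assoc, Rinv_l; lra. }
  pose proof (Int_part_pos _ H).
  unfold copies; change (cf_digit alpha (S (S n))) with (Int_part (/ gauss_iter alpha (S n))).
  rewrite <- lev_gauss; lia.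
Qed.

Lemma lev_len (n : nat) :
  (1 <= len_l (lev n))%nat /\ (1 <= len_s (lev n))%nat /\ (n <= len_l (lev n) + 1)%nat.
Proof.
  induction n as [|[|n] [IH1 [IH2 IH3]]]; [simpl; lia|simpl in *; lia|].
  destruct (lev_copies n) as [Ha1 _].
  change (lev (S (S n))) with (step (lev (S n))).
  set (v := lev (S n)) in *; cbn [step len_l len_s].
  nia.
Qed.

Lemma lev_len_ge (n : nat) : (4 <= n)%nat ->
  (n - 2 <= len_s (lev n))%nat /\ (2 <= len_l (lev n))%nat /\ (2 <= len_s (lev n))%nat.
Proof.
  intros Hn; destruct n as [|n]; [lia|].
  pose proof (lev_len n); pose proof (lev_len (S n)).
  change (len_s (lev (S n))) with (len_l (lev n)); lia.
Qed.

(** * Boundedness of the traces *)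

(** At level 0 the traces are [E], [E - lambda] and [E (E - lambda) - 2]. A step replaces them by
    [trpow] at [copies], the old long trace, and [trpow] at [copies + 1]. *)
Lemma lev_fricke (n : nat) :
  fricke (tr (mat_l (lev n))) (tr (mat_s (lev n))) (tr (mmul (mat_s (lev n)) (mat_l (lev n))))
  = RtoC (4 + lambda * lambda).
Proof.
  induction n as [|n IH].
  - unfold fricke, tr; simpl; rewrite RtoC_plus, RtoC_mult.
    replace (RtoC 4) with (RtoC 1 + RtoC 1 + RtoC 1 + RtoC 1)%C
      by (rewrite <- !RtoC_plus; f_equal; ring); ring.
  - rewrite <- IH; cbn [lev]; set (v := lev n).
    destruct (v_det _ _ _ (lev_valid n)) as [D1 _]; fold v in D1.
    simpl mat_l; simpl mat_s; rewrite trpow_succ_sym.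
    rewrite <- (fricke_trpow _ (mat_s v) (copies v) D1).
    change (tr (mmul (mat_s v) (mpow (mat_l v) (copies v)))) with
      (trpow (mat_l v) (mat_s v) (copies v)).
    unfold fricke; ring.
Qed.

Variable u : Z -> C.
Hypothesis Hu : forall n : Z,
  (u (n + 1)%Z = (E - RtoC (potential n)) * u n - u (n - 1)%Z)%C.
Lemma consecutive_traces (jm : Z) (n : nat) :
  u jm <> RtoC 0 -> (forall i, Cmod (u i) <= Cmod (u jm)) -> (4 <= n)%nat ->
  Cmod (tr (mat_l (lev n))) <= 2 \/ Cmod (tr (mat_l (lev (S n)))) <= 2.
Proof.
  intros Hjm Hmax Hn; destruct (lev_len_ge n Hn) as [_ [H1 H2]].
  destruct (square_centre_or_step _ E (lev n) jm (lev_valid n) (lev_rest n) H1 H2) as [H|H];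
    [left|right].
  - exact (square_at_max _ E u _ jm Hu (lev_valid n) H Hjm Hmax).
  - exact (square_at_max _ E u _ jm Hu (lev_valid (S n)) H Hjm Hmax).
Qed.

(** If the trace exceeds 2, both neighbouring levels have trace at most 2. Then [|z| <= 2] gives the
    Fricke bound [8 + (4 + lambda^2)], while [|z| > 2] would make the next trace exceed 2 by
    growth. *)
Lemma traces_bounded (jm : Z) (n : nat) :
  u jm <> RtoC 0 -> (forall i, Cmod (u i) <= Cmod (u jm)) -> (5 <= n)%nat ->
  Cmod (tr (mat_l (lev n))) <= 12 + lambda * lambda.
Proof.
  intros Hjm Hmax Hn; destruct n as [|n]; [lia|].
  destruct (Rle_dec (Cmod (tr (mat_l (lev (S n))))) 2) as [|Hx]; [nra|].
  destruct (consecutive_traces jm n Hjm Hmax ltac:(lia)) as [Hy|]; [|contradiction].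
  destruct (consecutive_traces jm (S n) Hjm Hmax ltac:(lia)) as [|Hnext]; [contradiction|].
  change (mat_l (lev n)) with (mat_s (lev (S n))) in Hy.
  set (z := tr (mmul (mat_s (lev (S n))) (mat_l (lev (S n))))).
  destruct (Rle_dec (Cmod z) 2) as [Hz|Hz].
  - pose proof (fricke_bound _ _ _ _ Hy Hz (lev_fricke (S n))) as H.
    rewrite Rabs_pos_eq in H; nra.
  - exfalso; destruct (lev_copies n) as [Ha1 _].
    destruct (v_det _ _ _ (lev_valid (S n))) as [D1 _].
    pose proof (trpow_grows _ (mat_s (lev (S n))) (pred (copies (lev (S n)))) D1
      ltac:(lra) ltac:(fold z; lra) ltac:(fold z; lra)) as H.
    replace (S (pred (copies (lev (S n))))) with (copies (lev (S n))) in H by lia.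
    change (mat_l (lev (S (S n)))) with
      (mmul (mat_s (lev (S n))) (mpow (mat_l (lev (S n))) (copies (lev (S n))))) in Hnext.
    unfold trpow in H; lra.
Qed.

Lemma square_beside_digits_ge_3 (j : Z) :
  (forall N, exists n, (N <= n)%nat /\ (3 <= cf_digit alpha n)%Z) ->
  forall N, exists n, (N <= n)%nat /\ square_beside potential (lev n) j.
Proof.
  (* 6 covers the index shift between digits and levels and makes the blocks long enough. *)
  intros H N; destruct (H (N + 6)%nat) as [n [Hn Hd]].
  destruct n as [|[|n]]; [lia|lia|]; exists (S n); split; [lia|].
  destruct (lev_copies n) as [_ Hc]; destruct (lev_len_ge (S n) ltac:(lia)) as [_ [H1 H2]].
  apply (square_beside_three _ E); auto using lev_valid, lev_rest; lia.
Qed.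

(** If [j] lies in a short block at some high level, a square starts there. Otherwise [j] stays in
    long blocks with a fixed start, and as these grow it becomes an early site. *)
Lemma square_beside_digits_1 (j : Z) :
  (exists N, forall n, (N <= n)%nat -> cf_digit alpha n = 1%Z) ->
  forall N, exists n, (N <= n)%nat /\ square_beside potential (lev n) j.
Proof.
  intros [N1 H1] N.
  set (M := (N + N1 + 5)%nat).
  destruct (Classical_Prop.classic (exists n b, (M <= n)%nat /\ is_s (lev (S n)) b /\
     (b <= j < next_s (lev (S n)) b)%Z)) as [[n [b [Hn [Hb Hj]]]]|Hno].
  { exists n; split; [lia|]; destruct n as [|n]; [lia|].
    destruct (lev_copies n) as [Hc _]; destruct (lev_len_ge (S n) ltac:(lia)) as [_ [L1 L2]].
    apply (square_beside_short _ E (lev (S n)) b); auto using lev_valid, lev_rest. }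
  assert (H0 : exists b, is_l (lev (S M)) b /\ (b <= j < next_l (lev (S M)) b)%Z).
  { destruct (v_cover _ _ _ (lev_valid (S M)) j) as [b [Hbj [[Hb Hj]|[Hb Hj]]]].
    - exists b; auto.
    - exfalso; apply Hno; exists M, b; auto. }
  destruct H0 as [b [Hb [Hbj Hj]]].
  (* From level [S M] on, [j] lies in a long block, and these blocks all start at [b]. *)
  assert (Hall : forall k, is_l (lev (S (M + k))) b /\ (j < next_l (lev (S (M + k))) b)%Z).
  { induction k as [|k [IH1 IH2]]; [now rewrite Nat.add_0_r|].
    rewrite Nat.add_succ_r; set (v := lev (S (M + k))) in *.
    assert (Hc : copies v = 1%nat).
    { destruct (lev_copies (M + k)) as [_ Hc]; rewrite H1 in Hc by (unfold M; lia).
      unfold v; lia. }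
    change (lev (S (S (M + k)))) with (step v).
    (* With one copy [gap_s + rest = gap_l], so starts of long blocks survive to the next level. *)
    assert (Hbase : base (step v) b).
    { split; [exact (proj1 IH1)|].
      replace (gap_s v + rest v) with (gap_l v); [exact (proj2 IH1)|].
      unfold rest; rewrite Hc; simpl; ring. }
    destruct (Classical_Prop.classic
      (below (closed_left (step v)) (coord (step v) b) (gap_l (step v)))) as [Hd|Hd].
    - split; [split; assumption|]; unfold next_l in IH2 |- *; cbn [step len_l]; rewrite Hc; lia.
    - exfalso; apply Hno; exists (S (M + k)), b; split; [lia|].
      split; [split; assumption|split; [exact Hbj|exact IH2]]. }
  (* High enough for [j - b <= len_s - 2]. *)
  set (m := (M + (Z.to_nat (j - b) + 5))%nat).
  assert (Hm : (Z.of_nat N + 5 <= Z.of_nat m /\ j - b + 5 <= Z.of_nat m)%Z) by (unfold m, M; lia).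
  exists (S m); split; [lia|].
  destruct (lev_len_ge (S m) ltac:(lia)) as [L0 [L1 L2]].
  destruct (lev_copies m) as [Hc _].
  apply (square_beside_long _ E (lev (S m)) b); auto using lev_valid, lev_rest.
  - replace (S m) with (M + S (Z.to_nat (j - b) + 5))%nat by (unfold m; lia).
    exact (proj1 (Hall _)).
  - lia.
Qed.

End Sturmian.

(** * Decay of eigenfunctions, the digit dichotomy and the contradiction *)

Lemma l2Z_small (u : Z -> C) (eps : R) : l2Z u -> 0 < eps ->
  exists K : nat, forall i, (Z.of_nat K <= Z.abs i)%Z -> Cmod (u i) <= eps.
Proof.
  intros [H1 H2] Heps.
  assert (Hside : forall w : nat -> C, ex_series (fun k => (Cmod (w k)) ^ 2) ->
    exists K, forall k, (K <= k)%nat -> Cmod (w k) <= eps).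
  { intros w Hw; apply ex_series_lim_0, is_lim_seq_spec in Hw.
    assert (He2 : 0 < eps ^ 2) by nra.
    destruct (Hw (mkposreal _ He2)) as [K HK]; exists K; intros k Hk.
    specialize (HK k Hk); simpl pos in HK; rewrite Rminus_0_r in HK.
    rewrite Rabs_pos_eq in HK by nra; pose proof (Cmod_ge_0 (w k)); nra. }
  destruct (Hside _ H1) as [K1 HK1], (Hside _ H2) as [K2 HK2].
  exists (Nat.max K1 K2); intros i Hi.
  destruct (Z.le_gt_cases 0 i).
  - replace i with (Z.of_nat (Z.to_nat i)) by lia; apply HK1; lia.
  - replace i with (- Z.of_nat (Z.to_nat (- i)))%Z by lia; apply HK2; lia.
Qed.

(** Off a finite range [|u| <= |u j|], so a maximum over that range that also dominates [u j] is
    global. *)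
Lemma l2Z_max (u : Z -> C) (j : Z) : l2Z u -> u j <> RtoC 0 ->
  exists m, u m <> RtoC 0 /\ forall i, Cmod (u i) <= Cmod (u m).
Proof.
  intros Hl Hj; pose proof (proj1 (Cmod_gt_0 _) Hj) as Hpos.
  destruct (l2Z_small u _ Hl Hpos) as [K HK].
  assert (Hfin : forall n : nat, exists m, Cmod (u j) <= Cmod (u m) /\
    forall i, (Z.abs i < Z.of_nat n)%Z -> Cmod (u i) <= Cmod (u m)).
  { induction n as [|n [m [IH1 IH2]]]; [exists j; split; [lra|lia]|].
    assert (Hsup : exists m', Cmod (u m) <= Cmod (u m') /\
      Cmod (u (Z.of_nat n)) <= Cmod (u m') /\ Cmod (u (- Z.of_nat n)%Z) <= Cmod (u m')).
    { destruct (Rle_dec (Cmod (u (Z.of_nat n))) (Cmod (u m)));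
      destruct (Rle_dec (Cmod (u (- Z.of_nat n)%Z)) (Cmod (u m)));
      destruct (Rle_dec (Cmod (u (- Z.of_nat n)%Z)) (Cmod (u (Z.of_nat n))));
      first [exists m; lra | exists (Z.of_nat n); lra | exists (- Z.of_nat n)%Z; lra]. }
    destruct Hsup as [m' [S1 [S2 S3]]]; exists m'; split; [lra|]; intros i Hi.
    destruct (Z.lt_ge_cases (Z.abs i) (Z.of_nat n)); [specialize (IH2 i ltac:(lia)); lra|].
    destruct (Z.le_gt_cases 0 i);
      [replace i with (Z.of_nat n) by lia | replace i with (- Z.of_nat n)%Z by lia]; assumption. }
  destruct (Hfin K) as [m [M1 M2]]; exists m; split.
  - apply Cmod_gt_0; lra.
  - intros i; destruct (Z.lt_ge_cases (Z.abs i) (Z.of_nat K)); [now apply M2|].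
    specialize (HK i ltac:(lia)); lra.
Qed.

(** Digits eventually at most 2 and infinitely often 2 would have limsup 2. Index 0 holds a dummy 0,
    and [lev_copies] gives positivity from index 2. *)
Lemma digits_dichotomy (d : nat -> Z) : (forall n, (2 <= n)%nat -> (1 <= d n)%Z) ->
  LimSup_seq (fun n => IZR (d n)) <> Finite 2 ->
  (forall N, exists n, (N <= n)%nat /\ (3 <= d n)%Z) \/
  (exists N, forall n, (N <= n)%nat -> d n = 1%Z).
Proof.
  intros H1 Hls.
  destruct (Classical_Prop.classic (exists N, forall n, (N <= n)%nat -> (d n <= 2)%Z))
    as [[N HN]|Hno].
  - right; apply Classical_Prop.NNPP; intros Hn; apply Hls, is_LimSup_seq_unique.
    intros eps; pose proof (cond_pos eps) as Heps; split.
    + intros M; apply Classical_Prop.NNPP; intros HM; apply Hn.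
      exists (M + N + 2)%nat; intros n Hn'.
      specialize (H1 n ltac:(lia)); specialize (HN n ltac:(lia)).
      destruct (Z.eq_dec (d n) 2) as [H2|H2]; [|lia].
      exfalso; apply HM; exists n; split; [lia|]; rewrite H2; lra.
    + exists N; intros n Hn'; specialize (HN n Hn'); apply IZR_le in HN; lra.
  - left; intros N; apply Classical_Prop.NNPP; intros HN; apply Hno.
    exists N; intros n Hn; apply Z.nlt_ge; intros Hd; apply HN; exists n; split; [exact Hn|lia].
Qed.

Theorem theorem1 (alpha : R) (Ha : 0 < alpha < 1) (Hirr : irrational alpha)
  (Hls : LimSup_seq (fun n => IZR (cf_digit alpha n)) <> Finite 2) :
  forall (lambda theta : R), lambda <> 0 -> 0 <= theta < 1 ->
  forall E : C, ~ is_eigenvalue lambda alpha theta E.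
Proof.
  intros lambda theta _ _ E [u [Hl2 [[j Hj] Heq]]].
  assert (Hu : forall n, (u (n + 1)%Z
    = (E - RtoC (potential alpha theta lambda n)) * u n - u (n - 1)%Z)%C).
  { intros n; specialize (Heq n); unfold H_op in Heq.
    unfold potential, Cminus; rewrite Cmult_plus_distr_r, <- Heq; ring. }
  destruct (l2Z_max u j Hl2 Hj) as [jm [Hjm Hmax]].
  assert (Hsq : forall N, exists n, (N <= n)%nat /\
    square_beside (potential alpha theta lambda) (lev alpha theta lambda E n) j).
  { destruct (digits_dichotomy (cf_digit alpha)) as [H|H]; [|exact Hls| |].
    - intros n Hn; destruct n as [|[|n]]; [lia|lia|].
      destruct (lev_copies alpha theta lambda E Ha Hirr n); lia.
    - now apply square_beside_digits_ge_3.
    - now apply square_beside_digits_1. }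
  (* The trace bound plus 1, the factor in [square_beside_bound]; the choice of epsilon below then
     yields [|u j| <= |u j| / 2]. *)
  set (B := 13 + lambda * lambda).
  assert (HB : 0 < B) by (unfold B; nra).
  pose proof (proj1 (Cmod_gt_0 _) Hj) as Hpos.
  assert (Heps : 0 < Cmod (u j) / (2 * B)) by (apply Rdiv_lt_0_compat; lra).
  destruct (l2Z_small u _ Hl2 Heps) as [K HK].
  (* Here [len_l >= K + |j|], so [|i - j| >= len_l] forces [|i| >= K]. *)
  destruct (Hsq (K + Z.to_nat (Z.abs j) + 5)%nat) as [n [Hn Hs]].
  pose proof (lev_len alpha theta lambda E Ha Hirr n) as [_ [_ Hlen]].
  pose proof (traces_bounded alpha theta lambda E Ha Hirr u Hu jm n Hjm Hmax ltac:(lia)) as Ht.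
  pose proof (square_beside_bound _ E u _ j _ Hu (lev_valid alpha theta lambda E Ha Hirr n) Hs
    (fun i Hi => HK i ltac:(lia))) as Hb.
  assert ((Cmod (tr (mat_l (lev alpha theta lambda E n))) + 1) * (Cmod (u j) / (2 * B))
    <= B * (Cmod (u j) / (2 * B))).
  { apply Rmult_le_compat_r; unfold B in *; lra. }
  replace (B * (Cmod (u j) / (2 * B))) with (Cmod (u j) / 2) in H by (field; lra).
  lra.
Qed.
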